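(* There exists a unique algebra homomorphism $\psi : U_q(\mathrm{so}_3)\to \hat U_q(\mathrm{sl}_2)$ such that $$\psi(I_1)=\frac{\mathrm i}{q-q^{-1}}\,(q^H-q^{-H}),\qquad \psi(I_2)=(E-F)(q^H+q^{-H})^{-1},$$ $$\psi(I_3)=(\mathrm i\,q^{H-1/2}E+\mathrm i\,q^{-H-1/2}F)(q^H+q^{-H})^{-1},$$ where $q^{H+a}:=q^Hq^a$ and $q^{-H+a}:=q^{-H}q^a$ for $a\in\mathbf C$.
   Context: Let $q\in\mathbf C$ with $q\neq 0$, $q\ne\pm1$, and fix a square root $q^{1/2}$; $\mathrm i=\sqrt{-1}$. All algebras are complex, associative, with unit. $U_q(\mathrm{so}_3)$ is the algebra generated by $I_1,I_2,I_3$ with defining relations $q^{1/2}I_1I_2-q^{-1/2}I_2I_1=I_3$, $q^{1/2}I_2I_3-q^{-1/2}I_3I_2=I_1$, $q^{1/2}I_3I_1-q^{-1/2}I_1I_3=I_2$. $U_q(\mathrm{sl}_2)$ is the algebra generated by $q^H,q^{-H},E,F$ with relations $q^Hq^{-H}=q^{-H}q^H=1$, $q^HEq^{-H}=qE$, $q^HFq^{-H}=q^{-1}F$, $EF-FE=\frac{q^{2H}-q^{-2H}}{q-q^{-1}}$, where $q^{\pm 2H}:=(q^{\pm H})^2$. $\hat U_q(\mathrm{sl}_2)$ is the algebra generated by $q^H,q^{-H},E,F$ and elements $(q^kq^H+q^{-k}q^{-H})^{-1}$, $k\in\mathbf Z$, with the relations of $U_q(\mathrm{sl}_2)$ together with,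 for all $k\in\mathbf Z$: $(q^kq^H+q^{-k}q^{-H})^{-1}(q^kq^H+q^{-k}q^{-H})=(q^kq^H+q^{-k}q^{-H})(q^kq^H+q^{-k}q^{-H})^{-1}=1$; $q^{\pm H}(q^kq^H+q^{-k}q^{-H})^{-1}=(q^kq^H+q^{-k}q^{-H})^{-1}q^{\pm H}$; $(q^kq^H+q^{-k}q^{-H})^{-1}E=E(q^{k+1}q^H+q^{-k-1}q^{-H})^{-1}$; $(q^kq^H+q^{-k}q^{-H})^{-1}F=F(q^{k-1}q^H+q^{-k+1}q^{-H})^{-1}$. *)

(* Defs.v *)
From HB Require Import structures.
From mathcomp Require Import all_boot all_order all_algebra.
From mathcomp Require Import complex boolp reals monalg.

Set Implicit Arguments.
Unset Strict Implicit.
Unset Printing Implicit Defensive.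

Import GRing.Theory.
Local Open Scope ring_scope.
Local Open Scope quotient_scope.

(* Algebras given by generators and relations: the quotient of the free       *)
(* associative unital algebra on X by the two-sided ideal generated by the    *)
(* differences u - v, for rel u v.                                            *)

Definition freeAlg (K : comNzRingType) (X : choiceType) :=
  {malg K[{fmonom X}]}.

Definition freeGen (K : comNzRingType) (X : choiceType) (x : X) :
  freeAlg K X := << fmu x >>.

Section Presentation.
Variables (K : comNzRingType) (X : choiceType).
Variable rel : freeAlg K X -> freeAlg K X -> Prop.

Inductive relIdeal : freeAlg K X -> Prop :=
| relIdeal0 : relIdeal 0
| relIdealD x y : relIdeal x -> relIdeal y -> relIdeal (x + y)
| relIdeal_gen a u v b : rel u v -> relIdeal (a * (u - v) * b).

Lemma relIdealMl a x : relIdeal x -> relIdeal (a * x).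
Proof.
elim=> [|y z _ Iy _ Iz|c u v b uv]; first by rewrite mulr0; apply: relIdeal0.
  by rewrite mulrDr; apply: relIdealD.
by rewrite !mulrA; apply: relIdeal_gen.
Qed.

Lemma relIdealMr a x : relIdeal x -> relIdeal (x * a).
Proof.
elim=> [|y z _ Iy _ Iz|c u v b uv]; first by rewrite mul0r; apply: relIdeal0.
  by rewrite mulrDl; apply: relIdealD.
by rewrite -mulrA; apply: relIdeal_gen.
Qed.

Definition relIdeal_pred : {pred freeAlg K X} := fun x => `[< relIdeal x >].

Lemma relIdeal_predE x : (x \in relIdeal_pred) = `[< relIdeal x >].
Proof. by []. Qed.

Fact relIdeal_zmod_closed : zmod_closed relIdeal_pred.
Proof.
split=> [|x y]; rewrite !relIdeal_predE; first exact/asboolP/relIdeal0.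
move=> /asboolP Ix /asboolP Iy; apply/asboolP/relIdealD => //.
by rewrite -mulN1r; apply: relIdealMl.
Qed.

HB.instance Definition _ :=
  GRing.isZmodClosed.Build (freeAlg K X) relIdeal_pred relIdeal_zmod_closed.

Definition presAlg : Type := {ideal_quot relIdeal_pred}.

HB.instance Definition _ := EqQuotient.on presAlg.
HB.instance Definition _ := GRing.Zmodule.on presAlg.

Definition presGen (x : X) : presAlg := \pi_presAlg (freeGen K x).

Lemma presAlg_piP (x y : freeAlg K X) :
  relIdeal (x - y) <-> \pi_presAlg x = \pi_presAlg y.
Proof.
split=> [Ixy|/eqP]; first by apply/eqP; rewrite -Quotient.idealrBE; apply/asboolP.
by rewrite -Quotient.idealrBE => /asboolP.
Qed.

Lemma presAlg_rel (x y : freeAlg K X) :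
  rel x y -> \pi_presAlg x = \pi_presAlg y.
Proof.
move=> xy; apply/presAlg_piP.
by rewrite -[_ - _]mul1r -[_ * _]mulr1; apply: relIdeal_gen.
Qed.

Definition presAlg_one : presAlg := lift_cst presAlg 1.
Definition presAlg_mul : presAlg -> presAlg -> presAlg := lift_op2 presAlg *%R.
Definition presAlg_scale (c : K) : presAlg -> presAlg :=
  lift_op1 presAlg ( *:%R c).

Lemma presAlg_piM x y :
  presAlg_mul (\pi_presAlg x) (\pi_presAlg y) = \pi_presAlg (x * y).
Proof.
unlock presAlg_mul; apply/presAlg_piP; set x' := repr _; set y' := repr _.
have -> : x' * y' - x * y = x' * (y' - y) + (x' - x) * y.
  by rewrite mulrBr mulrBl addrA subrK.
by apply: relIdealD; [apply: relIdealMl|apply: relIdealMr];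
  apply/presAlg_piP; rewrite reprK.
Qed.

Lemma presAlg_piZ c x :
  presAlg_scale c (\pi_presAlg x) = \pi_presAlg (c *: x).
Proof.
unlock presAlg_scale; apply/presAlg_piP; rewrite -scalerBr -[_ - _]mul1r scalerAl.
by apply/relIdealMl/presAlg_piP; rewrite reprK.
Qed.

Lemma presAlg_pi_one : presAlg_one = \pi_presAlg 1.
Proof. by unlock presAlg_one. Qed.

Lemma presAlg_piD x y : \pi_presAlg x + \pi_presAlg y = \pi_presAlg (x + y).
Proof. exact/esym/Quotient.pi_add. Qed.

Lemma presAlg_ind (P : presAlg -> Prop) :
  (forall x, P (\pi_presAlg x)) -> forall x, P x.
Proof. by move=> Ppi x; rewrite -[x]reprK. Qed.

Fact presAlg_mulA : associative presAlg_mul.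
Proof.
by elim/presAlg_ind=> x; elim/presAlg_ind=> y; elim/presAlg_ind=> z;
  rewrite !presAlg_piM mulrA.
Qed.

Fact presAlg_mul1 : left_id presAlg_one presAlg_mul.
Proof. by elim/presAlg_ind=> x; rewrite presAlg_pi_one presAlg_piM mul1r. Qed.

Fact presAlg_mulr1 : right_id presAlg_one presAlg_mul.
Proof. by elim/presAlg_ind=> x; rewrite presAlg_pi_one presAlg_piM mulr1. Qed.

Fact presAlg_mulDl : left_distributive presAlg_mul +%R.
Proof.
by elim/presAlg_ind=> x; elim/presAlg_ind=> y; elim/presAlg_ind=> z;
  rewrite !(presAlg_piD, presAlg_piM) mulrDl.
Qed.

Fact presAlg_mulDr : right_distributive presAlg_mul +%R.
Proof.
by elim/presAlg_ind=> x; elim/presAlg_ind=> y; elim/presAlg_ind=> z;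
  rewrite !(presAlg_piD, presAlg_piM) mulrDr.
Qed.

(* The quotient may be trivial, hence a pzRingType and an lmodType; the       *)
(* library's lalgType and algType require 1 != 0.                             *)
HB.instance Definition _ := GRing.Zmodule_isPzRing.Build presAlg
  presAlg_mulA presAlg_mul1 presAlg_mulr1 presAlg_mulDl presAlg_mulDr.

Fact presAlg_scaleA a b x :
  presAlg_scale a (presAlg_scale b x) = presAlg_scale (a * b) x.
Proof. by elim/presAlg_ind: x => x; rewrite !presAlg_piZ scalerA. Qed.

Fact presAlg_scale1 : left_id 1 presAlg_scale.
Proof. by elim/presAlg_ind=> x; rewrite presAlg_piZ scale1r. Qed.

Fact presAlg_scaleDr : right_distributive presAlg_scale +%R.
Proof.
move=> a; elim/presAlg_ind=> x; elim/presAlg_ind=> y.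
by rewrite !(presAlg_piD, presAlg_piZ) scalerDr.
Qed.

Fact presAlg_scaleDl x :
  {morph presAlg_scale^~ x : a b / a + b}.
Proof.
by elim/presAlg_ind: x => x a b; rewrite !presAlg_piZ presAlg_piD scalerDl.
Qed.

HB.instance Definition _ := GRing.Zmodule_isLmodule.Build K presAlg
  presAlg_scaleA presAlg_scale1 presAlg_scaleDr presAlg_scaleDl.

Lemma presAlg_pi1 : 1 = \pi_presAlg 1.
Proof. exact: presAlg_pi_one. Qed.

Lemma presAlg_piMr x y : \pi_presAlg x * \pi_presAlg y = \pi_presAlg (x * y).
Proof. exact: presAlg_piM. Qed.

Lemma presAlg_piZr c x : c *: \pi_presAlg x = \pi_presAlg (c *: x).
Proof. exact: presAlg_piZ. Qed.

Lemma presAlg_scaleAl (c : K) (x y : presAlg) : c *: (x * y) = c *: x * y.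
Proof.
elim/presAlg_ind: x => x; elim/presAlg_ind: y => y.
by rewrite !(presAlg_piMr, presAlg_piZr) scalerAl.
Qed.

Lemma malgC_comm (c : K) (x : freeAlg K X) : c%:MP * x = x * c%:MP.
Proof.
rewrite !malgM_def fgmulUg fgmulgU; apply: eq_bigr => m _.
by rewrite mul1m mulm1 mulrC.
Qed.

Lemma presAlg_scaleAr (c : K) (x y : presAlg) : c *: (x * y) = x * (c *: y).
Proof.
elim/presAlg_ind: x => x; elim/presAlg_ind: y => y.
rewrite !(presAlg_piMr, presAlg_piZr).
by rewrite -!mul_malgC !mulrA malgC_comm.
Qed.

End Presentation.

Definition alg_morphism (K : comNzRingType) (X Y : choiceType)
    (relX : freeAlg K X -> freeAlg K X -> Prop)
    (relY : freeAlg K Y -> freeAlg K Y -> Prop)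
    (f : presAlg relX -> presAlg relY) : Prop :=
  linear f /\ monoid_morphism f.

Inductive so3_gen := so3_I1 | so3_I2 | so3_I3.

Definition so3_gen_code (g : so3_gen) : nat :=
  match g with so3_I1 => 0 | so3_I2 => 1 | so3_I3 => 2 end.
Definition so3_gen_decode (n : nat) : option so3_gen :=
  match n with
  | 0 => Some so3_I1 | 1 => Some so3_I2 | 2 => Some so3_I3 | _ => None
  end.
Fact so3_gen_codeK : pcancel so3_gen_code so3_gen_decode.
Proof. by case. Qed.
HB.instance Definition _ := Choice.copy so3_gen (pcan_type so3_gen_codeK).

(* sl2_D k stands for the inverse of q^k q^H + q^-k q^-H. *)
Inductive sl2_gen := sl2_qH | sl2_qHV | sl2_E | sl2_F | sl2_D of int.

Definition sl2_gen_code (g : sl2_gen) : nat + int :=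
  match g with
  | sl2_qH => inl 0%N | sl2_qHV => inl 1%N | sl2_E => inl 2%N
  | sl2_F => inl 3%N | sl2_D k => inr k
  end.
Definition sl2_gen_decode (x : nat + int) : option sl2_gen :=
  match x with
  | inl 0 => Some sl2_qH | inl 1 => Some sl2_qHV | inl 2 => Some sl2_E
  | inl 3 => Some sl2_F | inl _ => None | inr k => Some (sl2_D k)
  end.
Fact sl2_gen_codeK : pcancel sl2_gen_code sl2_gen_decode.
Proof. by case. Qed.
HB.instance Definition _ := Choice.copy sl2_gen (pcan_type sl2_gen_codeK).

Section QuantumAlgebras.
Variable R : realType.
Local Notation C := R[i].

(* The parameter s is the chosen square root of q. *)
Section So3.
Variable s : C.
Let I1 := freeGen C so3_I1.
Let I2 := freeGen C so3_I2.
Let I3 := freeGen C so3_I3.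

Inductive so3_rel : freeAlg C so3_gen -> freeAlg C so3_gen -> Prop :=
| so3_rel12 : so3_rel (s *: (I1 * I2) - s^-1 *: (I2 * I1)) I3
| so3_rel23 : so3_rel (s *: (I2 * I3) - s^-1 *: (I3 * I2)) I1
| so3_rel31 : so3_rel (s *: (I3 * I1) - s^-1 *: (I1 * I3)) I2.

Definition Uq_so3 := presAlg so3_rel.
Definition Uso3_I1 : Uq_so3 := presGen so3_rel so3_I1.
Definition Uso3_I2 : Uq_so3 := presGen so3_rel so3_I2.
Definition Uso3_I3 : Uq_so3 := presGen so3_rel so3_I3.
End So3.

Section Sl2.
Variable q : C.
Let qH := freeGen C sl2_qH.
Let qHV := freeGen C sl2_qHV.
Let E := freeGen C sl2_E.
Let F := freeGen C sl2_F.
Let D k := freeGen C (sl2_D k).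
Let S (k : int) := q ^ k *: qH + q ^ (- k) *: qHV.

Inductive sl2_hat_rel : freeAlg C sl2_gen -> freeAlg C sl2_gen -> Prop :=
| sl2_rel_HHV : sl2_hat_rel (qH * qHV) 1
| sl2_rel_HVH : sl2_hat_rel (qHV * qH) 1
| sl2_rel_HE : sl2_hat_rel (qH * E * qHV) (q *: E)
| sl2_rel_HF : sl2_hat_rel (qH * F * qHV) (q^-1 *: F)
| sl2_rel_EF :
    sl2_hat_rel (E * F - F * E) ((q - q^-1)^-1 *: (qH ^+ 2 - qHV ^+ 2))
| sl2_hat_rel_DS k : sl2_hat_rel (D k * S k) 1
| sl2_hat_rel_SD k : sl2_hat_rel (S k * D k) 1
| sl2_hat_rel_HD k : sl2_hat_rel (qH * D k) (D k * qH)
| sl2_hat_rel_HVD k : sl2_hat_rel (qHV * D k) (D k * qHV)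
| sl2_hat_rel_DE k : sl2_hat_rel (D k * E) (E * D (k + 1))
| sl2_hat_rel_DF k : sl2_hat_rel (D k * F) (F * D (k - 1)).

Definition Uq_sl2_hat := presAlg sl2_hat_rel.
Definition Usl2_qH : Uq_sl2_hat := presGen sl2_hat_rel sl2_qH.
Definition Usl2_qHV : Uq_sl2_hat := presGen sl2_hat_rel sl2_qHV.
Definition Usl2_E : Uq_sl2_hat := presGen sl2_hat_rel sl2_E.
Definition Usl2_F : Uq_sl2_hat := presGen sl2_hat_rel sl2_F.
Definition Usl2_D (k : int) : Uq_sl2_hat := presGen sl2_hat_rel (sl2_D k).
End Sl2.

End QuantumAlgebras.

(* Main.v *)
Require Import Defs.
From mathcomp Require Import all_boot all_order all_algebra.
From mathcomp Require Import complex boolp reals.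
From HB Require Import structures.
From mathcomp Require Import finmap monalg.

Set Implicit Arguments.
Unset Strict Implicit.
Unset Printing Implicit Defensive.

Import GRing.Theory.
Local Open Scope ring_scope.
Local Open Scope quotient_scope.

(** A homomorphism out of an algebra given by generators and relations is the
    same thing as a choice of images of the generators that satisfies the
    relations ([presAlg_universal]).  Both existence and uniqueness therefore
    reduce to three identities in the target algebra.  Write K, K' for q^H and
    q^-H, D for the inverse of K + K', s for q^1/2, and

      J1 = c (K - K') with c = i / (q - 1/q),   J2 = (E - F) D,
      J3 = i/s (K E + K' F) D = i s (E K + F K') D;

    the two forms of J3 agree because K E = q E K and K' F = q F K'.

    - The relations s J1 J2 - J2 J1 / s = J3 and s J3 J1 - J1 J3 / s = J2: here
      J2 and J3 are (U + V) D with U, V of opposite weights under conjugation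
      by K.  Moving K and K' to the right past U gives a combination of U K D
      and U K' D, and likewise for V; one coefficient of each combination
      vanishes because the weights are s^2 and s^-2.  Both relations are
      instances of [weight_commutator]; the second one also uses K K' = 1 and
      i^2 = -1.

    - The relation s J2 J3 - J3 J2 / s = J1: using the first form of J3 in the
      first product and the second one in the other product, the scalars
      become equal and the left side is
      i ((E - F) D (K E + K' F) - (E K + F K') D (E - F)) D.  The E.E and F.F
      terms cancel, and the mixed terms recombine through D (K + K') = 1 into
      E F - F E ([EF_commutator]).  Finally (K^2 - K'^2) D = K - K' since
      K^2 - K'^2 = (K - K') (K + K').

    The identities are proved for arbitrary elements of a presented algebra
    over an arbitrary commutative ring, where scalars and inverses are given by
    equations such as s t = 1. *)

(** * Homomorphisms out of a presented algebra *)

Section Universal.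
Context (K : comNzRingType) (X Y : choiceType).
Context (relX : freeAlg K X -> freeAlg K X -> Prop).
Context (relY : freeAlg K Y -> freeAlg K Y -> Prop).

Let A := presAlg relY.

Section Eval.
Variable a : X -> A.

Definition wordEval (m : {fmonom X}) : A := \prod_(i <- m) a i.

(** The homomorphism from the free algebra that extends [a]. *)
Definition freeEval (x : freeAlg K X) : A :=
  \sum_(m <- msupp x) x@_m *: wordEval m.

Lemma freeEvalE x : freeEval x = \sum_(m <- msupp x) x@_m *: wordEval m.
Proof. by []. Qed.

Lemma wordEvalM : {morph wordEval : m n / mmul m n >-> m * n}.
Proof. by move=> m n; rewrite /wordEval fmM big_cat. Qed.

(** Summing over a common larger support is what allows evaluations of
    different elements to be added. *)
Lemma freeEval_fset (d : {fset {fmonom X}}) (x : freeAlg K X) :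
  fsubset (msupp x) d -> freeEval x = \sum_(m <- d) x@_m *: wordEval m.
Proof.
move=> xd; apply: big_fset_incl => // m _ mNx.
by rewrite mcoeff_outdom ?scale0r.
Qed.

Fact freeEval_linear : linear freeEval.
Proof.
move=> c x y.
pose d := fsetU (msupp (c *: x + y)) (fsetU (msupp x) (msupp y)).
rewrite (@freeEval_fset d (c *: x + y)) ?fsubsetUl //.
have sub_d z :
    fsubset (msupp z) (fsetU (msupp x) (msupp y)) -> fsubset (msupp z) d.
  by move=> /fsubset_trans; apply; apply: fsubsetUr.
rewrite (@freeEval_fset d x) ?sub_d ?fsubsetUl //.
rewrite (@freeEval_fset d y) ?sub_d ?fsubsetUr //.
rewrite scaler_sumr -big_split; apply: eq_bigr => m _ /=.
by rewrite mcoeffD mcoeffZ scalerDl scalerA.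
Qed.

HB.instance Definition _ :=
  GRing.isLinear.Build K (freeAlg K X) A *:%R freeEval freeEval_linear.

Lemma freeEvalU c m : freeEval << c *g m >> = c *: wordEval m.
Proof.
rewrite (@freeEval_fset [fset m]%fset) ?msuppU_le//.
by rewrite big_seq_fset1 mcoeffUU.
Qed.

Lemma freeEval1 : freeEval 1 = 1.
Proof. by rewrite freeEvalU scale1r /wordEval fm1 big_nil. Qed.

Lemma freeEvalM : {morph freeEval : x y / x * y}.
Proof.
move=> x y; rewrite malgME linear_sum [freeEval x]freeEvalE mulr_suml.
apply: eq_bigr => m _; rewrite linear_sum [freeEval y]freeEvalE mulr_sumr.
apply: eq_bigr => n _ /=.
by rewrite freeEvalU wordEvalM -presAlg_scaleAl -presAlg_scaleAr scalerA.
Qed.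

Lemma freeEval_gen i : freeEval (freeGen K i) = a i.
Proof. by rewrite freeEvalU scale1r /wordEval fmU big_seq1. Qed.

Lemma freeEvalD : {morph freeEval : x y / x + y}.
Proof. exact: linearD. Qed.

Lemma freeEvalB : {morph freeEval : x y / x - y}.
Proof. exact: linearB. Qed.

Lemma freeEvalZ c : {morph freeEval : x / c *: x}.
Proof. exact: linearZ. Qed.

(** Composing [f] with the projection from the free algebra gives a linear
    multiplicative map, which is determined on words by its values on letters
    and then on all elements by linearity: this is the uniqueness half of the
    universal property. *)
Lemma alg_morphism_freeEval (f : presAlg relX -> A) :
    alg_morphism f -> (forall i, f (presGen relX i) = a i) ->
  forall x, f (\pi_(presAlg relX) x) = freeEval x.
Proof.
move=> [flin [f1 fM]] fa x.
pose f0 : {linear presAlg relX -> A} :=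
  HB.pack f (GRing.isLinear.Build _ _ _ _ f flin).
have fpi_lin : linear (f0 \o \pi_(presAlg relX)).
  by move=> c u v /=; rewrite -presAlg_piD -presAlg_piZr; apply: flin.
pose g : {linear freeAlg K X -> A} :=
  HB.pack (f0 \o \pi_(presAlg relX)) (GRing.isLinear.Build _ _ _ _ _ fpi_lin).
have gM u v : g (u * v) = g u * g v by rewrite /= -presAlg_piMr; apply: fM.
have gword (m : {fmonom X}) : g << m >> = wordEval m.
  case: m => w; rewrite /wordEval /=; elim: w => [|i w IHw].
    by rewrite big_nil -fmoneE -presAlg_pi1; apply: f1.
  have -> : << FMonom (i :: w) >> = freeGen K i * << FMonom w >>.
    rewrite malgM_def fgmulUU mulr1; congr << _ *g _ >>.
    by apply/eqP; rewrite fmP fmM fmU.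
  by rewrite [LHS]gM big_cons [g (freeGen K i)]fa; congr (_ * _).
rewrite -[LHS]/(g x) [x in LHS]monalgE linear_sum; apply: eq_bigr => m _.
have -> : << x@_m *g m >> = x@_m *: << m >> :> freeAlg K X.
  by rewrite -mul_malgC malgM_def fgmulUU mulr1 mul1m.
by rewrite linearZ; congr (_ *: _); apply: gword.
Qed.

End Eval.

(** Universal property of a presentation.  The evaluation kills the ideal
    generated by the relations, so it can be computed on any representative of
    a class. *)
Theorem presAlg_universal (a : X -> A) :
    (forall u v, relX u v -> freeEval a u = freeEval a v) ->
  exists! f : presAlg relX -> A,
    alg_morphism f /\ (forall i, f (presGen relX i) = a i).
Proof.
move=> a_rel.
have a_ideal x : relIdeal relX x -> freeEval a x = 0.
  elim=> [|y z _ IHy _ IHz|b u v c uv]; first exact: linear0.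
    by rewrite linearD /= IHy IHz addr0.
  by rewrite !freeEvalM linearB /= (a_rel u v uv) subrr mulr0 mul0r.
pose f (y : presAlg relX) := freeEval a (repr y).
have f_pi x : f (\pi_(presAlg relX) x) = freeEval a x.
  apply/eqP; rewrite -subr_eq0 -linearB /=; apply/eqP/a_ideal/presAlg_piP.
  exact: reprK.
exists f; split=> [|g [gmor ga]].
  split=> [|i]; last by rewrite f_pi freeEval_gen.
  split; last split; last 1 first.
  - elim/presAlg_ind=> x; elim/presAlg_ind=> y.
    by rewrite presAlg_piMr !f_pi freeEvalM.
  - move=> c; elim/presAlg_ind=> x; elim/presAlg_ind=> y.
    by rewrite presAlg_piZr presAlg_piD !f_pi linearP.
  - by rewrite [X in f X]presAlg_pi1 f_pi freeEval1.
apply: funext; elim/presAlg_ind=> x.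
by rewrite f_pi (alg_morphism_freeEval gmor ga).
Qed.

End Universal.

(** The identity is the homomorphism that fixes the generators, so evaluation
    at the generators is the projection to the quotient.  Relations between
    free generators thus become relations in the presented algebra that can be
    expanded with the morphism rules of [freeEval]. *)
Lemma freeEval_presGen (K : comNzRingType) (X : choiceType)
    (rel : freeAlg K X -> freeAlg K X -> Prop) (u v : freeAlg K X) :
  rel u v -> freeEval (presGen rel) u = freeEval (presGen rel) v.
Proof.
move=> /presAlg_rel uv.
have idP : alg_morphism (@id (presAlg rel)) by split; [|split].
by rewrite -!(alg_morphism_freeEval idP).
Qed.

(** * Identities in a presented algebra *)

Section Computations.
Context (K : comNzRingType) (X : choiceType).
Context (rel : freeAlg K X -> freeAlg K X -> Prop).
Implicit Types (H Hv U E F D : presAlg rel).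

(** Turns the conjugation form of the relations between the torus and [E], [F]
    into rules that move the torus to the right. *)
Lemma weight_of_conj (a b : K) H Hv U :
    b * a = 1 -> H * Hv = 1 -> Hv * H = 1 -> H * U * Hv = a *: U ->
  H * U = a *: (U * H) /\ Hv * U = b *: (U * Hv).
Proof.
move=> ba HHv HvH HUHv; split.
  by rewrite presAlg_scaleAl -HUHv -mulrA HvH mulr1.
rewrite -[U in RHS]mul1r -HvH -!mulrA [H * (U * Hv)]mulrA HUHv.
by rewrite -presAlg_scaleAr scalerA ba scale1r.
Qed.

(** [U] and [V] have opposite weights, so moving [H - Hv] to the right
    multiplies [U * H] and [V * Hv] by [p * a + r], and [U * Hv] and [V * H]
    by [p * b + r]; the last hypothesis makes the latter terms vanish.  With
    [(a, b) = (q, 1/q)] and [(p, r) = (s, -1/s)], or with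
    [(a, b) = (1/q, q)] and [(p, r) = (-1/s, s)], the left side is a
    q-commutator with the image of I1. *)
Lemma weight_commutator (c p r a b : K) H Hv U V D :
    H * U = a *: (U * H) -> Hv * U = b *: (U * Hv) ->
    H * V = b *: (V * H) -> Hv * V = a *: (V * Hv) ->
    H * D = D * H -> Hv * D = D * Hv -> p * b + r = 0 ->
  p *: ((c *: (H - Hv)) * ((U + V) * D)) + r *: ((U + V) * D * (c *: (H - Hv)))
  = (c * (p * a + r)) *: ((U * H - V * Hv) * D).
Proof.
move=> HU HvU HV HvV HD HvD pbr.
have D_out : (U + V) * D * (H - Hv) = (U + V) * (H - Hv) * D.
  by rewrite -!mulrA; congr (_ * _); rewrite mulrBl mulrBr HD HvD.
rewrite -presAlg_scaleAl -presAlg_scaleAr D_out mulrA.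
rewrite [p *: _]scalerA [r *: _]scalerA ![_ * c]mulrC -!scalerA -scalerDr.
congr (_ *: _); rewrite !presAlg_scaleAl -mulrDl; congr (_ * _).
rewrite -!presAlg_scaleAl !mulrDl !mulrDr !mulNr !mulrN HU HvU HV HvV.
rewrite !scalerDr !scalerN !scalerA.
(* Pairs the terms by monomial: U H, V Hv, then V H and U Hv, which cancel. *)
rewrite [LHS](AC (2*2*(2*2)) ((1*5)*(4*8)*(2*7*(3*6)))) /=.
by rewrite -!opprD -!scalerDl pbr !scale0r subr0 addr0.
Qed.

(** After expansion, the products [E H D E] and [F Hv D F] occur with both
    signs.  The other terms pair up as [x H D y + x Hv D y], which is
    [x (H + Hv) D y = x y], for [(x, y)] equal to [(E, F)] and [(F, E)]. *)
Lemma EF_commutator H Hv E F D :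
    H * D = D * H -> Hv * D = D * Hv -> D * (H + Hv) = 1 ->
  (E - F) * D * (H * E + Hv * F) - (E * H + F * Hv) * D * (E - F) =
  E * F - F * E.
Proof.
move=> HD HvD DS.
have moveH x y : x * D * (H * y) = x * H * D * y.
  by rewrite !mulrA -(mulrA x D) -HD mulrA.
have moveHv x y : x * D * (Hv * y) = x * Hv * D * y.
  by rewrite !mulrA -(mulrA x D) -HvD mulrA.
have split_one x y : x * H * D * y + x * Hv * D * y = x * y.
  rewrite -!mulrDl -mulrDr -(mulrA x); congr (_ * _).
  by rewrite [in _ * D]mulrDl HD HvD -mulrDr DS mulr1.
rewrite -(split_one E F) -(split_one F E).
rewrite !(mulrDl, mulrDr, mulrBl, mulrBr, mulNr, mulrN) !moveH !moveHv.
rewrite !opprD !opprK.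
(* Terms 1 and 5 are those in E H D E, terms 4 and 8 those in F Hv D F. *)
rewrite [LHS](AC (2*2*(2*2)) ((7*3)*(2*6)*(1*5)*(8*4))) /= !subrr !addr0.
by [].
Qed.

End Computations.

(** * From relations of a presentation to identities *)

Section Transport.
Context (K : comNzRingType) (X : choiceType).
Context (rel : freeAlg K X -> freeAlg K X -> Prop).
Local Notation g := (@freeGen K X).
Local Notation G := (presGen rel).

(** The next lemmas carry the shapes of relations that occur below from the
    free algebra to the quotient.  They are separate statements over an
    abstract ring because unification between free algebra terms is costly over
    concrete complex numbers.  For the same reason, the rewrites are directed
    to explicit positions. *)
Lemma presGen_inv x y : rel (g x * g y) 1 -> G x * G y = 1.
Proof.
by move/freeEval_presGen; rewrite [LHS]freeEvalM freeEval1 2!freeEval_gen.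
Qed.

Lemma presGen_comm x y : rel (g x * g y) (g y * g x) -> G x * G y = G y * G x.
Proof.
by move/freeEval_presGen; rewrite [LHS]freeEvalM [RHS]freeEvalM 2!freeEval_gen.
Qed.

Lemma presGen_conj x y z c :
  rel (g x * g y * g z) (c *: g y) -> G x * G y * G z = c *: G y.
Proof.
move/freeEval_presGen; rewrite [LHS]freeEvalM [RHS]freeEvalZ.
by rewrite [X in X * _]freeEvalM 3!freeEval_gen.
Qed.

Lemma presGen_sum_inv x y z :
  rel (g x * (g y + g z)) 1 -> G x * (G y + G z) = 1.
Proof.
move/freeEval_presGen; rewrite [LHS]freeEvalM freeEval1.
by rewrite [X in _ * X]freeEvalD 3!freeEval_gen.
Qed.

Lemma presGen_commutator x y z w c :
    rel (g x * g y - g y * g x) (c *: (g z ^+ 2 - g w ^+ 2)) ->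
  G x * G y - G y * G x = c *: (G z * G z - G w * G w).
Proof.
move/freeEval_presGen; rewrite [LHS]freeEvalB [RHS]freeEvalZ.
rewrite [X in X - _ = _]freeEvalM [X in _ - X = _]freeEvalM !expr2.
rewrite [X in _ = _ *: X]freeEvalB [X in _ = _ *: (X - _)]freeEvalM.
by rewrite [X in _ = _ *: (_ - X)]freeEvalM 4!freeEval_gen.
Qed.

Lemma freeEval_qcomm (Y : choiceType) (a : Y -> presAlg rel) b c x y :
  freeEval a (b *: (freeGen K x * freeGen K y)
              - c *: (freeGen K y * freeGen K x)) =
  b *: (a x * a y) - c *: (a y * a x).
Proof.
rewrite freeEvalB [X in X - _ = _]freeEvalZ [X in _ - X = _]freeEvalZ.
rewrite [X in _ *: X - _ = _]freeEvalM [X in _ - _ *: X = _]freeEvalM.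
by rewrite !freeEval_gen.
Qed.

End Transport.

(** * The relations of so_3 in terms of sl_2 *)

Section So3InSl2.
Context (K : comNzRingType) (X : choiceType).
Context (rel : freeAlg K X -> freeAlg K X -> Prop).
Context (H Hv E F D : presAlg rel) (s t k iota : K).

(** The relations of U_q(sl_2) with an inverse [D] of [H + Hv], where
    [s * s] and [t * t] play the parts of q and 1/q, and [k] that of the
    coefficient 1/(q - 1/q). *)
Record sl2_relations : Prop := Sl2Relations {
  sl2_HHv : H * Hv = 1;
  sl2_HvH : Hv * H = 1;
  sl2_HE : H * E * Hv = (s * s) *: E;
  sl2_HF : H * F * Hv = (t * t) *: F;
  sl2_EF : E * F - F * E = k *: (H * H - Hv * Hv);
  sl2_HD : H * D = D * H;
  sl2_HvD : Hv * D = D * Hv;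
  sl2_DS : D * (H + Hv) = 1
}.

Hypothesis sl2 : sl2_relations.
Hypothesis st1 : s * t = 1.
Hypothesis k_inv : k * (s * s - t * t) = 1.
Hypothesis iota_sq : iota * iota = -1.

Let HHv := sl2_HHv sl2.
Let HvH := sl2_HvH sl2.
Let HD := sl2_HD sl2.
Let HvD := sl2_HvD sl2.

Let J1 := (iota * k) *: (H - Hv).
Let J2 := (E - F) * D.
Let J3 := (iota *: ((t *: H) * E) + iota *: ((t *: Hv) * F)) * D.

Let ts1 : t * s = 1. Proof. by rewrite mulrC. Qed.

Let weightE : H * E = (s * s) *: (E * H) /\ Hv * E = (t * t) *: (E * Hv).
Proof.
by apply: weight_of_conj HHv HvH (sl2_HE sl2); rewrite mulrACA ts1 mulr1.
Qed.

Let weightF : H * F = (t * t) *: (F * H) /\ Hv * F = (s * s) *: (F * Hv).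
Proof.
by apply: weight_of_conj HHv HvH (sl2_HF sl2); rewrite mulrACA st1 mulr1.
Qed.

Let J3_left : J3 = (iota * t) *: ((H * E + Hv * F) * D).
Proof.
by rewrite /J3 -!presAlg_scaleAl !scalerA -scalerDr -presAlg_scaleAl.
Qed.

Let J3_right : J3 = (iota * s) *: ((E * H + F * Hv) * D).
Proof.
rewrite J3_left weightE.1 weightF.2 -scalerDr -presAlg_scaleAl scalerA.
by rewrite -mulrA [t * _]mulrA ts1 mul1r.
Qed.

(** [J2] is [(U + V) * D] for [U := E] and [V := - F]. *)
Lemma so3_rel12_image : s *: (J1 * J2) - t *: (J2 * J1) = J3.
Proof.
have [HE HvE] := weightE; have [HF HvF] := weightF.
rewrite -scaleNr (@weight_commutator _ _ _ _ s (- t) (s * s) (t * t));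
  rewrite ?mulrN ?mulNr ?HF ?HvF ?scalerN //; last first.
  by rewrite mulrA st1 mul1r subrr.
rewrite J3_right opprK; apply: (congr1 (fun x => x *: _)).
rewrite -[in RHS](mul1r s) -k_inv -!mulrA; congr (_ * (_ * _)).
by rewrite mulrBl -!mulrA ts1 mulr1.
Qed.

(** Writing the two occurrences of [J3] with the torus on different sides makes
    both coefficients equal to [iota]. *)
Lemma so3_rel23_image : s *: (J2 * J3) - t *: (J3 * J2) = J1.
Proof.
rewrite {1}J3_left J3_right -presAlg_scaleAl -presAlg_scaleAr !scalerA.
rewrite mulrCA st1 [t * _]mulrCA ts1 mulr1 -scalerBr /J2 !mulrA -!mulrBl.
rewrite EF_commutator ?(sl2_DS sl2) // (sl2_EF sl2) -presAlg_scaleAl scalerA.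
congr (_ *: _).
have -> : H * H - Hv * Hv = (H - Hv) * (H + Hv).
  by rewrite mulrBl !mulrDr HHv HvH opprD addrA addrK.
by rewrite -mulrA [_ * D]mulrDl HD HvD -mulrDr (sl2_DS sl2) mulr1.
Qed.

(** [J3] is a multiple of [(U + V) * D] for [U := F * Hv] and [V := E * H],
    which have the weights of [F] and [E]; the extra factors [Hv] and [H] are
    then cancelled by those of [J1]. *)
Lemma so3_rel31_image : s *: (J3 * J1) - t *: (J1 * J3) = J2.
Proof.
have [HE HvE] := weightE; have [HF HvF] := weightF.
have HFHv : H * (F * Hv) = (t * t) *: (F * Hv * H).
  by rewrite mulrA HF -presAlg_scaleAl -!mulrA HHv HvH.
have HvFHv : Hv * (F * Hv) = (s * s) *: (F * Hv * Hv).
  by rewrite mulrA HvF -presAlg_scaleAl.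
have HEH : H * (E * H) = (s * s) *: (E * H * H).
  by rewrite mulrA HE -presAlg_scaleAl.
have HvEH : Hv * (E * H) = (t * t) *: (E * H * Hv).
  by rewrite mulrA HvE -presAlg_scaleAl -!mulrA HHv HvH.
rewrite J3_right -presAlg_scaleAl -presAlg_scaleAr; set a := iota * s.
rewrite !scalerA ![_ * a]mulrC -!(scalerA a) -scalerBr.
rewrite [E * H + _]addrC [s *: _ - _]addrC -scaleNr.
rewrite (@weight_commutator _ _ _ _ (- t) s (t * t) (s * s)) //; last first.
  by rewrite mulNr mulrA ts1 mul1r addNr.
rewrite -(mulrA F) -(mulrA E) HHv HvH !mulr1 scalerA.
have -> : a * (iota * k * (- t * (t * t) + s)) = -1.
  have -> : - t * (t * t) + s = t * (s * s - t * t).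
    by rewrite mulrBr [t * (s * s)]mulrA ts1 mul1r mulNr addrC.
  rewrite /a -(mulrA iota k) mulrACA iota_sq [k * _]mulrCA k_inv.
  by rewrite mulr1 st1 mulr1.
by rewrite scaleN1r -mulNr opprB.
Qed.

End So3InSl2.

Theorem proposition2 (R : realType) (q s : R[i])
  (q_neq0 : q != 0) (q_neq1 : q != 1) (q_neqN1 : q != -1) (s_sqrt : s ^+ 2 = q) :
  exists! psi : Uq_so3 s -> Uq_sl2_hat q,
    [/\ alg_morphism psi,
        psi (Uso3_I1 s) = ('i%C / (q - q^-1)) *: (Usl2_qH q - Usl2_qHV q),
        psi (Uso3_I2 s) = (Usl2_E q - Usl2_F q) * Usl2_D q 0
      & psi (Uso3_I3 s) =
          ('i%C *: ((s^-1 *: Usl2_qH q) * Usl2_E q)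
           + 'i%C *: ((s^-1 *: Usl2_qHV q) * Usl2_F q)) * Usl2_D q 0].
Proof.
have s_neq0 : s != 0.
  by apply: contraNneq q_neq0 => s0; rewrite -s_sqrt s0 expr0n.
have qV_neq0 : q - q^-1 != 0.
  rewrite subr_eq0 -(inj_eq (mulIf q_neq0)) mulVf // -expr2 sqrf_eq1.
  by rewrite negb_or q_neq1.
have st1 : s * s^-1 = 1 by apply: mulfV.
have ssq : s * s = q by rewrite -expr2.
have ttqV : s^-1 * s^-1 = q^-1 by rewrite -ssq invfM.
have k_inv : (q - q^-1)^-1 * (s * s - s^-1 * s^-1) = 1.
  by rewrite ssq ttqV; apply: mulVf.
have iota_sq : 'i%C * 'i%C = -1 :> R[i] by rewrite -expr2 sqr_i.
have rel_HE := sl2_rel_HE q; rewrite -[X in X *: _]ssq in rel_HE.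
have rel_HF := sl2_rel_HF q; rewrite -[X in X *: _]ttqV in rel_HF.
have rel_DS := sl2_hat_rel_DS q 0; rewrite oppr0 expr0z !scale1r in rel_DS.
have sl2 : sl2_relations (Usl2_qH q) (Usl2_qHV q) (Usl2_E q) (Usl2_F q)
    (Usl2_D q 0) s s^-1 (q - q^-1)^-1.
  split.
  - exact: presGen_inv (sl2_rel_HHV q).
  - exact: presGen_inv (sl2_rel_HVH q).
  - exact: presGen_conj rel_HE.
  - exact: presGen_conj rel_HF.
  - exact: presGen_commutator (sl2_rel_EF q).
  - exact: presGen_comm (sl2_hat_rel_HD q 0).
  - exact: presGen_comm (sl2_hat_rel_HVD q 0).
  - exact: presGen_sum_inv rel_DS.
pose a x := match x with
  | so3_I1 => ('i%C / (q - q^-1)) *: (Usl2_qH q - Usl2_qHV q)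
  | so3_I2 => (Usl2_E q - Usl2_F q) * Usl2_D q 0
  | so3_I3 => ('i%C *: ((s^-1 *: Usl2_qH q) * Usl2_E q)
      + 'i%C *: ((s^-1 *: Usl2_qHV q) * Usl2_F q)) * Usl2_D q 0
  end.
have [|psi [[psi_mor psi_a] psi_uniq]] :=
  @presAlg_universal _ _ _ (@so3_rel R s) (@sl2_hat_rel R q) a; last first.
  exists psi; split=> [|phi [phi_mor phi1 phi2 phi3]].
    split; [exact: psi_mor | exact: (psi_a so3_I1) | exact: (psi_a so3_I2)
           | exact: (psi_a so3_I3)].
  by apply: psi_uniq; split=> // -[].
move=> u v [].
- apply: (etrans (freeEval_qcomm a _ _ _ _)); rewrite freeEval_gen.
  exact: so3_rel12_image sl2 st1 k_inv.
- apply: (etrans (freeEval_qcomm a _ _ _ _)); rewrite freeEval_gen.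
  exact: so3_rel23_image sl2 st1.
- apply: (etrans (freeEval_qcomm a _ _ _ _)); rewrite freeEval_gen.
  exact: so3_rel31_image sl2 st1 k_inv iota_sq.
Qed.
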